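(* Let $G$ be a finite group or a compact Lie group, let $\mathcal{H}$ be a finite dimensional Hilbert space and let $\Theta:g\mapsto\Theta(g)$ be a unitary representation of $G$ on $\mathcal{H}$. Let $N\in\mathbb{N}$ and let $|\psi^N\rangle\in\mathcal{H}^{\otimes N}$ be a vector with a local symmetry, i.e. $$\Theta(g_1)\otimes\Theta(g_2)\otimes\cdots\otimes\Theta(g_N)|\psi^N\rangle=|\psi^N\rangle\qquad\forall g_1,g_2,\dots,g_N\in G .$$ Then $|\psi^N\rangle\in\mathcal{H}_0^{\otimes N}$, where $\mathcal{H}_0\subset\mathcal{H}$ is the subspace on which $\Theta$ acts trivially, i.e. $\mathcal{H}_0=\{v\in\mathcal{H}:\Theta(g)v=v\ \forall g\in G\}$.
   Context: All representations are unitary and finite dimensional. *)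

(* Defs.v *)
From HB Require Import structures.
From mathcomp Require Import all_boot all_order all_algebra.
From mathcomp Require Import complex.
From mathcomp Require Import all_classical all_reals all_analysis.

Set Implicit Arguments.
Unset Strict Implicit.
Unset Printing Implicit Defensive.

Import Order.TTheory GRing.Theory Num.Theory.
Import numFieldNormedType.Exports.

Local Open Scope classical_set_scope.
Local Open Scope ring_scope.

HB.mixin Record isTopologicalGroup G & Topological G & Group G := {
  mulg_continuous : continuous (fun p : G * G => (p.1 * p.2)%g) ;
  invg_continuous : continuous (fun x : G => (x^-1)%g)
}.

#[short(type="topologicalGroupType")]
HB.structure Definition TopologicalGroup :=
  {G of Topological G & Group G & isTopologicalGroup G}.

Section Smooth.
Variable R : realType.

(* Only used with [D] open, so that the partial derivatives at a point of [D]
   do not depend on the values of [f] outside [D]. *)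
Fixpoint Ck n m (k : nat) (D : set 'rV[R]_n) (f : 'rV[R]_n -> 'rV[R]_m)
    : Prop :=
  {in D, continuous f} /\
  if k is k'.+1 then
    forall i : 'I_n, (forall x, D x -> derivable f x (delta_mx 0 i)) /\
                     Ck k' D ('D_(delta_mx 0 i) f)
  else True.

Definition smooth n m (D : set 'rV[R]_n) (f : 'rV[R]_n -> 'rV[R]_m) :=
  forall k, Ck k D f.

End Smooth.

Section LieGroup.
Variables (R : realType) (G : topologicalGroupType).

Record chart (n : nat) := Chart {
  chart_dom : set G ;
  chart_map : G -> 'rV[R]_n ;
  chart_inv : 'rV[R]_n -> G ;
  chart_dom_open : open chart_dom ;
  chart_cod_open : open (chart_map @` chart_dom) ;
  chart_mapK : {in chart_dom, cancel chart_map chart_inv} ;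
  chart_map_continuous : {in chart_dom, continuous chart_map} ;
  chart_inv_continuous : {in chart_map @` chart_dom, continuous chart_inv}
}.

Definition chart_cod n (c : chart n) : set 'rV[R]_n :=
  chart_map c @` chart_dom c.

(* The product manifold G * G is read in the charts [a] and [b] through the
   identification of 'rV_n * 'rV_n with 'rV_(n + n). *)
Record lie_atlas n (A : set (chart n)) : Prop := LieAtlas {
  atlas_cover : forall x, exists2 c, A c & chart_dom c x ;
  atlas_smooth : forall a b, A a -> A b ->
    smooth (chart_map a @` (chart_dom a `&` chart_dom b))
           (fun x => chart_map b (chart_inv a x)) ;
  atlas_mul_smooth : forall a b c, A a -> A b -> A c ->
    smooth [set z : 'rV[R]_(n + n) |
              [/\ chart_cod a (lsubmx z), chart_cod b (rsubmx z) &
                  chart_dom c (chart_inv a (lsubmx z) *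
                               chart_inv b (rsubmx z))%g]]
           (fun z => chart_map c (chart_inv a (lsubmx z) *
                                  chart_inv b (rsubmx z))%g) ;
  atlas_inv_smooth : forall a b, A a -> A b ->
    smooth [set x | chart_cod a x /\ chart_dom b (chart_inv a x)^-1%g]
           (fun x => chart_map b (chart_inv a x)^-1%g)
}.

Definition lie_group : Prop :=
  [/\ hausdorff_space G, @second_countable G &
      exists n, exists A : set (chart n), lie_atlas A].

Definition compact_lie_group : Prop := lie_group /\ compact [set: G].

(* A finite group carries the discrete topology. *)
Definition finite_group : Prop :=
  finite_set [set: G] /\ forall A : set G, open A.

End LieGroup.

Section Representation.
Variables (R : realType) (G : topologicalGroupType) (H : vectType R[i]).
(* The inner product of H, linear in its first argument. *)
Variable dot : {dot H for @Num.conj R[i]}.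

Record unitary_representation (Theta : G -> 'End(H)) : Prop := UnitaryRep {
  rep_one : Theta 1%g = \1%VF ;
  rep_mul : forall g h : G, Theta (g * h)%g = (Theta g \o Theta h)%VF ;
  rep_unitary : forall g, isometry dot dot (Theta g) ;
  (* R[i]^o carries the norm topology of R[i]; in finite dimension, continuity
     of all matrix coefficients is continuity of Theta itself. *)
  rep_continuous : forall u v, continuous (fun g => dot (Theta g u) v : R[i]^o)
}.

Definition invariants (Theta : G -> 'End(H)) : set H :=
  [set v | forall g, Theta g v = v].

End Representation.

Section TensorPower.
Variables (C : fieldType) (H : vectType C) (N : nat).

(* Vectors are represented by their coordinates in the basis of N-fold pure
   tensors built from the basis [vbasis fullv] of H; [tensor_power_univ] below
   is the universal property, so nothing depends on this choice. *)
Definition tensor_power := {ffun {ffun 'I_N -> 'I_(\dim {:H})} -> C^o}.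

Definition pure_tensor (v : 'I_N -> H) : tensor_power :=
  [ffun i : {ffun 'I_N -> 'I_(\dim {:H})} =>
     \prod_(k < N) coord (vbasis {:H}) (i k) (v k)].

(* The linear map A 0 (x) ... (x) A (N-1). *)
Definition tensor_map (A : 'I_N -> 'End(H)) (psi : tensor_power)
    : tensor_power :=
  \sum_(i : {ffun 'I_N -> 'I_(\dim {:H})})
     psi i *: pure_tensor (fun k => A k (vbasis {:H})`_(i k)).

(* The N-th tensor power of a subspace W, as a subspace of that of H. *)
Definition tensor_span (W : set H) : set tensor_power :=
  [set psi | exists m (c : 'I_m -> C) (v : 'I_m -> 'I_N -> H),
     (forall j k, W (v j k)) /\ psi = \sum_(j < m) c j *: pure_tensor (v j)].

Definition set_arg (v : 'I_N -> H) (k : 'I_N) (x : H) : 'I_N -> H :=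
  fun l => if l == k then x else v l.

Definition multilinear (W : lmodType C) (f : ('I_N -> H) -> W) :=
  forall (v : 'I_N -> H) (k : 'I_N), linear (fun x : H => f (set_arg v k x)).


Local Notation e := (vbasis {:H}).
Local Notation idx := {ffun 'I_N -> 'I_(\dim {:H})}.

Lemma coord_vbasisE (a b : 'I_(\dim {:H})) : coord e a e`_b = (b == a)%:R.
Proof. by rewrite coord_free 1?eq_sym// (basis_free (vbasisP _)). Qed.

Lemma prod_set_arg (F : 'I_N -> H -> C) (v : 'I_N -> H) k x :
  \prod_l F l (set_arg v k x l) = F k x * \prod_(l | l != k) F l (v l).
Proof.
rewrite (bigD1 k)//= /set_arg eqxx; congr (_ * _).
by apply: eq_bigr => l /negPf ->.
Qed.

Lemma pure_tensor_multilinear : multilinear pure_tensor.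
Proof.
move=> v k a x y; apply/ffunP => i; rewrite !ffunE.
rewrite !(prod_set_arg (fun l => coord e (i l)) v).
by rewrite linearP mulrDl -mulrA.
Qed.

Lemma multilinear_expand (W : lmodType C) (f : ('I_N -> H) -> W) v :
  multilinear f ->
  f v = \sum_(i : idx) pure_tensor v i *: f (fun k => e`_(i k)).
Proof.
move=> fL.
suff expand (s : seq 'I_N) : forall w,
    (forall k, k \notin s -> exists a : 'I_(\dim {:H}), w k = e`_a) ->
    f w = \sum_(i : idx) pure_tensor w i *: f (fun k => e`_(i k)).
  by apply: (expand (enum 'I_N)) => k; rewrite mem_enum.
elim: s => [|k s IHs] w ws.
  have [j wj] : exists j : 'I_N -> 'I_(\dim {:H}), forall k, w k = e`_(j k).
    by have /fin_all_exists[j wj] := fun k => ws k isT; exists j.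
  have -> : w = fun k => e`_((finfun j) k).
    by apply/funext => k; rewrite ffunE.
  rewrite (bigD1 (finfun j))//= big1 ?addr0 => [|i ij]; rewrite ffunE.
    by rewrite big1 ?scale1r// => k _; rewrite coord_vbasisE eqxx.
  have [k jk] : exists k, finfun j k != i k.
    apply/existsP; apply: contraNT ij; rewrite negb_exists => /forallP ij.
    by apply/eqP/ffunP => k; have := ij k; rewrite negbK => /eqP.
  by rewrite (bigD1 k)//= coord_vbasisE (negPf jk) mul0r scale0r.
have expand_k (V : lmodType C) (h : ('I_N -> H) -> V) : multilinear h ->
    h w = \sum_a coord e a (w k) *: h (set_arg w k e`_a).
  move=> hL; pose hk x := h (set_arg w k x).
  pose hkL := GRing.isLinear.Build C H V *:%R hk (hL w k).
  pose hkl : {linear H -> V} := HB.pack hk hkL.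
  have -> : h w = hkl (w k).
    by congr h; apply/funext => l; rewrite /set_arg; case: eqP => [->|].
  rewrite [in LHS](coord_vbasis (memvf (w k))) linear_sum.
  by apply: eq_bigr => a _; rewrite linearZ.
rewrite (expand_k _ _ fL).
under eq_bigr => a _.
  rewrite IHs; last first.
    move=> l ls; rewrite /set_arg; case: eqP => [_|/eqP lk]; first by exists a.
    by apply: ws; rewrite inE negb_or lk.
  rewrite scaler_sumr; over.
rewrite exchange_big; apply: eq_bigr => i _ /=.
rewrite (expand_k _ _ pure_tensor_multilinear) sum_ffunE scaler_suml.
apply: eq_bigr => a _; rewrite scalerA; congr (_ *: _).
by rewrite [RHS]ffunE.
Qed.

Lemma tensor_power_basis (psi : tensor_power) :
  psi = \sum_(i : idx) psi i *: pure_tensor (fun k => e`_(i k)).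
Proof.
apply/ffunP => j; rewrite sum_ffunE (bigD1 j)//= big1 => [|i ij].
  rewrite addr0 !ffunE big1 ?mulr1 => [|k _]; last by rewrite coord_vbasisE eqxx.
  exact/esym/mulr1.
have [k ijk] : exists k, i k != j k.
  apply/existsP; apply: contraNT ij; rewrite negb_exists => /forallP ij.
  by apply/eqP/ffunP => k; have := ij k; rewrite negbK => /eqP.
by rewrite !ffunE (bigD1 k)//= coord_vbasisE (negPf ijk) mul0r scaler0.
Qed.

Lemma tensor_power_univ (W : lmodType C) (f : ('I_N -> H) -> W) :
  multilinear f ->
  exists! F : tensor_power -> W,
    linear F /\ forall v, F (pure_tensor v) = f v.
Proof.
move=> fL; exists (fun psi => \sum_(i : idx) psi i *: f (fun k => e`_(i k))).
split=> [|F [FL Fpure]].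
  split=> [a x y|v]; last by rewrite -multilinear_expand.
  rewrite scaler_sumr -big_split; apply: eq_bigr => i _ /=.
  by rewrite !ffunE scalerDl scalerA.
pose FL' := GRing.isLinear.Build C tensor_power W *:%R F FL.
pose Fl : {linear tensor_power -> W} := HB.pack F FL'.
apply/funext => psi; rewrite -[RHS]/(Fl psi) [in RHS](tensor_power_basis psi).
rewrite linear_sum; apply: eq_bigr => i _; rewrite linearZ.
by congr (_ *: _); rewrite -[RHS]/(F _) Fpure.
Qed.

Lemma tensor_map_linear (A : 'I_N -> 'End(H)) : linear (tensor_map A).
Proof.
move=> a x y; rewrite /tensor_map scaler_sumr -big_split.
by apply: eq_bigr => i _ /=; rewrite !ffunE scalerDl scalerA.
Qed.

Lemma tensor_map_pure (A : 'I_N -> 'End(H)) v :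
  tensor_map A (pure_tensor v) = pure_tensor (fun k => A k (v k)).
Proof.
have AL : multilinear (fun v => pure_tensor (fun k => A k (v k))).
  move=> w k a x y /=; have argE z : (fun l => A l (set_arg w k z l)) =
      set_arg (fun l => A l (w l)) k (A k z).
    by apply/funext => l; rewrite /set_arg; case: eqP => [->|].
  by rewrite !argE linearP; exact: pure_tensor_multilinear.
exact/esym/(multilinear_expand v AL).
Qed.

End TensorPower.

(* Main.v *)
(* Slicing along the k-th tensor factor turns the action of an operator on that
   factor into its action on vectors of H.  Hence every slice of psi is fixed by
   Theta, and so by a linear projection P onto the invariants; applying P to each
   factor in turn gives psi = P^(⊗N) psi, which is a combination of pure tensors
   of invariant vectors. *)
Require Import Defs.
From HB Require Import structures.
From mathcomp Require Import all_boot all_order all_algebra.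
From mathcomp Require Import complex.
From mathcomp Require Import all_classical all_reals all_analysis.

Set Implicit Arguments.
Unset Strict Implicit.
Unset Printing Implicit Defensive.

Local Open Scope classical_set_scope.
Local Open Scope ring_scope.

Import GRing.Theory.

(** Take [U] of maximal dimension among the subspaces contained in [S]. For [v] in [S], the sum of
    [U] and the line of [v] still lies in [S], so by maximality it equals [U]. *)
Lemma vspace_of_set (C : fieldType) (H : vectType C) (S : set H) :
  S 0 -> (forall a u v, S u -> S v -> S (a *: u + v)) ->
  exists U : {vspace H}, forall v, v \in U <-> S v.
Proof.
move=> S0 SL.
pose sub_dim n := `[< exists U : {vspace H},
  (forall v, v \in U -> S v) /\ \dim U = n >].
have ex_dim : exists n, sub_dim n.
  exists 0%N; apply/asboolP; exists 0%VS; split=> [v|]; last exact: dimv0.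
  by rewrite memv0 => /eqP ->.
have dim_le n : sub_dim n -> (n <= \dim {:H})%N.
  by move=> /asboolP[U [_ <-]]; exact/dimvS/subvf.
case: (ex_maxnP ex_dim dim_le) => n /asboolP[U [US dimU]] maxn.
exists U => v; split=> [|Sv]; first exact: US.
have UvS : sub_dim (\dim (U + <[v]>)%VS).
  apply/asboolP; exists (U + <[v]>)%VS; split=> // w.
  move=> /memv_addP[u uU [_ /vlineP[a ->] ->]].
  by rewrite addrC; apply: SL => //; exact: US.
have /eqP -> : U == (U + <[v]>)%VS by rewrite eqEdim addvSl dimU maxn.
exact/(subvP (addvSr U <[v]>))/memv_line.
Qed.

Section TensorSlices.
Variables (C : fieldType) (H : vectType C) (N : nat).
Implicit Types (psi : tensor_power H N) (A B : 'I_N -> 'End(H)).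

Local Notation e := (vbasis {:H}).
Local Notation idx := {ffun 'I_N -> 'I_(\dim {:H})}.
Implicit Type j : idx.

Lemma tensor_map_sum (I : finType) A (F : I -> tensor_power H N) (c : I -> C) :
  tensor_map A (\sum_i c i *: F i) = \sum_i c i *: tensor_map A (F i).
Proof.
pose AL := GRing.isLinear.Build C _ _ *:%R (tensor_map A)
  (@tensor_map_linear _ _ _ A).
pose Al : {linear tensor_power H N -> tensor_power H N} :=
  HB.pack (tensor_map A) AL.
rewrite -[LHS]/(Al _) linear_sum.
by apply: eq_bigr => i _; rewrite linearZ.
Qed.

Lemma tensor_map_comp A B psi :
  tensor_map A (tensor_map B psi) = tensor_map (fun k => A k \o B k)%VF psi.
Proof.
rewrite [tensor_map B psi]/tensor_map tensor_map_sum.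
apply: eq_bigr => i _; rewrite tensor_map_pure; congr (_ *: pure_tensor _).
by apply/funext => k; rewrite comp_lfunE.
Qed.

Lemma tensor_map1 psi : tensor_map (fun=> \1%VF) psi = psi.
Proof.
rewrite [RHS]tensor_power_basis; apply: eq_bigr => i _.
by congr (_ *: pure_tensor _); apply/funext => k; rewrite id_lfunE.
Qed.

Definition slot_map (k : 'I_N) (f : 'End(H)) : 'I_N -> 'End(H) :=
  fun l => if l == k then f else \1%VF.

Definition set_idx (j : idx) (k : 'I_N) (a : 'I_(\dim {:H})) : idx :=
  [ffun l => if l == k then a else j l].

(** Contraction of [psi] with the dual basis vectors [coord e (j l)] in all factors [l != k]. The
    entry [j k] is overwritten, so [j] can stay a full multi-index. *)
Definition slice (k : 'I_N) (j : idx) psi : H :=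
  \sum_a psi (set_idx j k a) *: e`_a.

(** Putting [j k] back in slot [k] restores [j]. Hence, for any single [k], the slices along [k]
    determine [psi]. *)
Lemma coord_slice k j psi : coord e (j k) (slice k j psi) = psi j.
Proof.
rewrite coord_sum_free ?(basis_free (vbasisP _))//; congr (psi _).
by apply/ffunP => l; rewrite ffunE; case: eqP => [->|].
Qed.

Lemma slice_linear k j : linear (slice k j).
Proof.
move=> a x y; rewrite /slice scaler_sumr -big_split.
by apply: eq_bigr => b _ /=; rewrite !ffunE scalerDl scalerA.
Qed.

Lemma slice_sum (I : finType) k j (F : I -> tensor_power H N) (c : I -> C) :
  slice k j (\sum_i c i *: F i) = \sum_i c i *: slice k j (F i).
Proof.
pose sL := GRing.isLinear.Build C _ _ *:%R (slice k j) (slice_linear k j).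
pose sl : {linear tensor_power H N -> H} := HB.pack (slice k j) sL.
rewrite -[LHS]/(sl _) linear_sum.
by apply: eq_bigr => i _; rewrite linearZ.
Qed.

Lemma slice_pure k j (v : 'I_N -> H) :
  slice k j (pure_tensor v) =
    (\prod_(l | l != k) coord e (j l) (v l)) *: v k.
Proof.
rewrite [in RHS](coord_vbasis (memvf (v k))) scaler_sumr.
apply: eq_bigr => a _; rewrite scalerA ffunE (bigD1 k)//= ffunE eqxx mulrC.
congr (_ * _ *: _); apply: eq_bigr => l /negPf lk.
by rewrite ffunE lk.
Qed.

(** The contraction involves only the factors other than [k], where [slot_map k f] is the identity.
    By linearity it suffices to compare both sides on pure tensors of basis vectors. *)
Lemma slice_slot_map k j f psi :
  slice k j (tensor_map (slot_map k f) psi) = f (slice k j psi).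
Proof.
rewrite /tensor_map [in RHS](tensor_power_basis psi) !slice_sum linear_sum.
apply: eq_bigr => i _; rewrite linearZ /= !slice_pure [f _]linearZ /=.
rewrite {2}/slot_map eqxx; congr (_ *: (_ *: _)).
by apply: eq_bigr => l /negPf lk; rewrite /slot_map lk id_lfunE.
Qed.

Lemma slot_map_fixedP k f psi :
  tensor_map (slot_map k f) psi = psi <->
  forall j, f (slice k j psi) = slice k j psi.
Proof.
split=> [fpsi j|fpsi]; first by rewrite -slice_slot_map fpsi.
by apply/ffunP => j; rewrite -(coord_slice k) slice_slot_map fpsi coord_slice.
Qed.

Lemma tensor_map_fixed (f : 'End(H)) psi :
  (forall k, tensor_map (slot_map k f) psi = psi) ->
  tensor_map (fun=> f) psi = psi.
Proof.
move=> fpsi.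
(* Apply [f] to the factors in [s] one at a time; [uniq s] ensures that no factor receives [f]
   twice. *)
have fixed_on (s : seq 'I_N) : uniq s ->
    tensor_map (fun l => if l \in s then f else \1%VF) psi = psi.
  elim: s => [_|k s IHs /= /andP[ks us]]; first exact: tensor_map1.
  rewrite -[RHS](fpsi k) -[in RHS](IHs us) tensor_map_comp; congr tensor_map.
  apply/funext => l; rewrite /slot_map inE.
  have [->|_] := eqVneq l k; last by rewrite comp_lfun1l.
  by rewrite (negPf ks) comp_lfun1r.
rewrite -[RHS](fixed_on _ (enum_uniq 'I_N)); congr tensor_map.
by apply/funext => l; rewrite mem_enum.
Qed.

Lemma tensor_span_map (W : set H) A psi :
  (forall k v, W (A k v)) -> tensor_span W (tensor_map A psi).
Proof.
move=> AW; exists #|{: idx}|, (fun m => psi (enum_val m)).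
exists (fun m k => A k e`_((enum_val m : idx) k)); split=> [m k|]; first exact: AW.
by rewrite /tensor_map (reindex _ (onW_bij _ (enum_val_bij _))).
Qed.

End TensorSlices.

Theorem proposition1 (R : realType) (G : topologicalGroupType)
  (hG : finite_group G \/ compact_lie_group R G)
  (H : vectType R[i]) (dot : {dot H for @Num.conj R[i]})
  (Theta : G -> 'End(H)) (hTheta : unitary_representation dot Theta)
  (N : nat) (psi : tensor_power H N)
  (hpsi : forall g : 'I_N -> G, tensor_map (fun k => Theta (g k)) psi = psi) :
  tensor_span (invariants Theta) psi.
Proof.
(* Turning the set of invariants into a subspace [U] makes the projection [projv U] available. *)
have [|a u v uI vI g|U UI] := @vspace_of_set _ H (invariants Theta).
- by move=> g; rewrite linear0.
- by rewrite linearP /= uI vI.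
have projI k : tensor_map (slot_map k (projv U)) psi = psi.
  apply/slot_map_fixedP => j; apply/projv_id/UI => g.
  apply: (slot_map_fixedP k (Theta g) psi).1.
  (* Taking [g] in slot [k] and the unit elsewhere turns the local symmetry into invariance under
     [slot_map k (Theta g)]. *)
  rewrite -[RHS](hpsi (fun l => if l == k then g else 1%g)).
  congr tensor_map; apply/funext => l; rewrite /slot_map.
  by case: ifP => // _; rewrite (rep_one hTheta).
rewrite -(tensor_map_fixed projI); apply: tensor_span_map => k v.
exact/UI/memv_proj.
Qed.
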